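(* Let $P$ be a (naturally labeled) poset on $n$ elements with a unique maximal element $\hat 1$. Then, for $1 \le k \le \mathrm{ht}(P)$, $$n! \cdot \mathrm{vol}\, \Delta(P,k) \;=\; \big|\{ \tau \in \mathrm{DC}(P) : \mathrm{des}_P(\tau) = k-1 \}\big| ,$$ where $\mathrm{vol}$ is the standard Euclidean ($n$-dimensional Lebesgue) volume on $\mathbb{R}^P = \mathbb{R}^n$.
   Context: All posets are finite. For a poset $(P,\preceq)$, $a \lessdot b$ denotes a cover relation, and $\check{P} = P \cup \{\hat 0\}$ is $P$ with a new minimum $\hat 0$ adjoined (even if $P$ already has a minimum). The height $\mathrm{ht}(P)$ is the maximal number of elements in a chain of $P$. Lipschitz polytope: $\mathcal{L}(P) \subset \mathbb{R}^P$ is the set of all $f : P \to \mathbb{R}$ with $0 \le f(a) \le 1$ for every minimal element $a$ of $P$ and $0 \le f(b)-f(a) \le 1$ for every cover relation $a \lessdot b$ in $P$. The $(P,k)$-hypersimplex is $\Delta(P,k) = \{f \in \mathcal{L}(P) : k-1 \le f(\hat 1) \le k\}$. $P$ is naturally labeled if its ground set is $\{1,\dots,n\}$, $n = |P|$, and $a \prec b$ implies $a < b$ as integers; one sets $\hat 0 := 0$. For $\tau \in \mathfrak{S}_n$ set $\tau(0) := 0$. For a saturated chain $C = \{\hat 0 = c_1 \lessdot \cdots \lessdot c_k = a\}$ in $\check{P}$ let $\mathrm{des}(\tau|_C)$ be the number of $1 \le j < k$ with $\tau(c_j) > \tau(c_{j+1})$. The permutation $\tau$ is descent-compatible with $P$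 if for every $a \in P$ the number $\mathrm{des}(\tau|_C)$ is the same for all saturated chains $C$ in $\check{P}$ from $\hat 0$ to $a$; then $\mathrm{des}_{P,\tau}(a)$ denotes this common number. $\mathrm{DC}(P) \subseteq \mathfrak{S}_n$ is the set of descent-compatible permutations, and for $\tau \in \mathrm{DC}(P)$ the number of $P$-descents is $\mathrm{des}_P(\tau) := \mathrm{des}_{P,\tau}(\hat 1)$. *)

(* Defs.v *)
From HB Require Import structures.
From mathcomp Require Import all_boot all_order all_algebra all_fingroup.
From mathcomp Require Import all_classical all_reals all_analysis.

Set Implicit Arguments.
Unset Strict Implicit.
Unset Printing Implicit Defensive.

Import Order.TTheory GRing.Theory Num.Theory.

Local Open Scope classical_set_scope.
Local Open Scope ring_scope.

(** Lebesgue measure on R^n.  Points are [n.-tuple (measurableTypeR R)], with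
    the product sigma-algebra of the library.  The measure is the n-fold product
    of [lebesgue_measure]: the point mass on R^0, then the product measure on
    R * R^n transported along (x, t) |-> x :: t. *)

Section LebesgueTuple.
Variable R : realType.

Definition cons_pair (n : nat)
    (p : measurableTypeR R * n.-tuple (measurableTypeR R)) :
    n.+1.-tuple (measurableTypeR R) := [tuple of p.1 :: p.2].

Definition uncons_pair (n : nat) (t : n.+1.-tuple (measurableTypeR R)) :
    measurableTypeR R * n.-tuple (measurableTypeR R) :=
  (thead t, [tuple of behead t]).

Lemma cons_pairK (n : nat) : cancel (@cons_pair n) (@uncons_pair n).
Proof.
by move=> -[x t]; rewrite /uncons_pair/=; congr pair; exact/val_inj.
Qed.

Lemma measurable_cons_pair (n : nat) : measurable_fun setT (@cons_pair n).
Proof. by apply: measurable_cons. Qed.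

Lemma measurable_uncons_pair (n : nat) :
  measurable_fun setT (@uncons_pair n).
Proof.
apply/measurable_fun_pairP; split; last exact: measurable_behead.
exact: (@measurable_tnth _ _ _ ord0).
Qed.

Section Step.
Variables (n : nat)
  (mu : {sigma_finite_measure set (n.-tuple (measurableTypeR R)) -> \bar R}).

Definition lebesgue_step : set (n.+1.-tuple (measurableTypeR R)) -> \bar R :=
  pushforward (@lebesgue_measure R \x mu)%E (@cons_pair n).

Let mc := @measurable_cons_pair n.

Let lebesgue_step0 : lebesgue_step set0 = 0%E.
Proof. exact: measure0. Qed.

Let lebesgue_step_ge0 A : (0 <= lebesgue_step A)%E.
Proof. exact: measure_ge0. Qed.

Let lebesgue_step_sigma_additive : semi_sigma_additive lebesgue_step.
Proof. exact: measure_semi_sigma_additive. Qed.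

HB.instance Definition _ := isMeasure.Build _ _ _ lebesgue_step
  lebesgue_step0 lebesgue_step_ge0 lebesgue_step_sigma_additive.

(* Done by hand: the sigma-finite instance on products of sigma-finite measures
   is hidden in the library by the one on products of subprobabilities. *)
Let lebesgue_step_sigma_finite : sigma_finite setT lebesgue_step.
Proof.
have /sigma_finiteP[F [FT ndF Foo]] := sigma_finiteT (@lebesgue_measure R).
have /sigma_finiteP[G [GT ndG Goo]] := sigma_finiteT mu.
exists (fun i => @uncons_pair n @^-1` (F i `*` G i)).
  rewrite -preimage_bigcup (_ : \bigcup_i _ = setT) ?preimage_setT//.
  apply/seteqP; split => // -[x t] _.
  have [i _ Fix] : (\bigcup_i F i) x by rewrite -FT.
  have [j _ Gjt] : (\bigcup_i G i) t by rewrite -GT.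
  exists (maxn i j) => //; split.
    by move: (x) Fix; exact/subsetPset/ndF/leq_maxl.
  by move: (t) Gjt; exact/subsetPset/ndG/leq_maxr.
move=> i; have [mF Fi] := Foo i; have [mG Gi] := Goo i; split.
  rewrite -[X in measurable X]setTI.
  by apply: measurable_uncons_pair => //; exact: measurableX.
rewrite /lebesgue_step /pushforward -comp_preimage.
rewrite (_ : _ \o _ = id); last by apply/funext => p; exact: cons_pairK.
by rewrite preimage_id product_measure1E// lte_mul_pinfty// ge0_fin_numE.
Qed.

HB.instance Definition _ := Measure_isSigmaFinite.Build _ _ _ lebesgue_step
  lebesgue_step_sigma_finite.

End Step.

Fixpoint lebesgue_tuple (n : nat) :
    {sigma_finite_measure set (n.-tuple (measurableTypeR R)) -> \bar R} :=
  match n with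
  | 0 => \d_ [tuple]
  | n'.+1 => lebesgue_step (lebesgue_tuple n')
  end.

Lemma lebesgue_tuple_box (n : nat) (a b : 'I_n -> R) :
  (forall i, a i <= b i) ->
  lebesgue_tuple n [set t | forall i, a i <= tnth t i <= b i] =
  (\prod_(i < n) (b i - a i))%:E.
Proof.
have mbox m (c d : 'I_m -> R) : measurable
    [set t : m.-tuple (measurableTypeR R) | forall i, c i <= tnth t i <= d i].
  rewrite [X in measurable X](_ : _ = \bigcap_(i in [set: 'I_m])
      (fun t => tnth t i) @^-1` `[c i, d i]); last first.
    by apply/seteqP; split => t /= h i; have := h i; rewrite /= ?in_itv//=; apply.
  apply: fin_bigcap_measurable => // i _; rewrite -[X in measurable X]setTI.
  by apply: measurable_tnth => //; exact: measurable_itv.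
elim: n a b => [|n IH] a b ab /=.
  by rewrite big_ord0 diracE mem_set//= => -[].
rewrite /lebesgue_step /pushforward.
rewrite (_ : _ @^-1` _ = `[a ord0, b ord0]%classic `*`
    [set t : n.-tuple (measurableTypeR R) | forall i,
      a (lift ord0 i) <= tnth t i <= b (lift ord0 i)]); last first.
  apply/seteqP; split => -[x t] /=.
    move=> h; split; first by rewrite in_itv/=; exact: (h ord0).
    by move=> i; have := h (lift ord0 i); rewrite tnthS.
  rewrite in_itv/= => -[hx ht] i; case: (unliftP ord0 i) => [j ->|->//].
  by rewrite tnthS; exact: ht.
rewrite product_measure1E//; last exact: mbox.
rewrite IH; last by move=> i; exact: ab.
rewrite big_ord_recl EFinM; congr (_ * _)%E.
rewrite [LHS](lebesgue_measure_itv `[a ord0, b ord0])/= lte_fin; case: ltP => // ba.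
have -> : a ord0 = b ord0 by apply/le_anti; rewrite ab ba.
by rewrite subrr.
Qed.

End LebesgueTuple.

Section Poset.
Variables (T : finType) (r : rel T).

Definition poset_rel : Prop := [/\ reflexive r, antisymmetric r & transitive r].

Definition covers : rel T := fun a b =>
  [&& r a b, a != b & [forall c, r a c && r c b ==> (c == a) || (c == b)]].

Definition minimal (a : T) : Prop := forall b, r b a -> b = a.

Definition maximal (a : T) : Prop := forall b, r a b -> b = a.

Definition unique_maximal (a : T) : Prop := forall b, maximal b <-> b = a.

Definition is_chain (C : {set T}) : bool :=
  [forall a in C, forall b in C, r a b || r b a].

Definition height : nat := \max_(C : {set T} | is_chain C) #|C|.

(** [C] lists, from bottom to top, a saturated chain from [x] to [y]. *)
Definition saturated_chain (x y : T) (C : seq T) : bool :=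
  if C is c :: s then [&& c == x, path covers c s & last c s == y] else false.

(** The poset with a new minimum, [None], adjoined. *)
Definition adjoin_bot : rel (option T) := fun x y =>
  match x, y with
  | None, _ => true
  | Some a, Some b => r a b
  | Some _, None => false
  end.

End Poset.

(** A ground set {1, ..., n} is represented by ['I_n], with [i] standing for the
    integer i + 1. *)

Section NaturallyLabeled.
Variables (n : nat) (r : rel 'I_n).

Definition naturally_labeled : Prop :=
  forall a b : 'I_n, r a b -> a != b -> (a < b)%N.

(** A permutation as a map {0, ..., n} -> {0, ..., n} fixing 0 = [None]. *)
Definition perm_label (tau : 'S_n) (x : option 'I_n) : nat :=
  if x is Some a then (tau a).+1 else 0%N.

Definition des_chain (tau : 'S_n) (C : seq (option 'I_n)) : nat :=
  (\sum_(j < (size C).-1)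
    (perm_label tau (nth None C j.+1) < perm_label tau (nth None C j)))%N.

Definition descent_compatible (tau : 'S_n) : Prop :=
  forall (a : 'I_n) (C D : seq (option 'I_n)),
    saturated_chain (adjoin_bot r) None (Some a) C ->
    saturated_chain (adjoin_bot r) None (Some a) D ->
    des_chain tau C = des_chain tau D.

Definition DC : {set 'S_n} := [set tau | `[< descent_compatible tau >]]%SET.

(** The common number of descents of the saturated chains up to [a]; this is
    only meaningful when [tau] is descent-compatible. *)
Definition poset_des (tau : 'S_n) (a : 'I_n) : nat :=
  xget 0%N [set d | exists2 C : seq (option 'I_n),
    saturated_chain (adjoin_bot r) None (Some a) C & des_chain tau C = d].

End NaturallyLabeled.

Section Polytopes.
Variables (R : realType) (n : nat) (r : rel 'I_n).

Definition lipschitz_polytope : set (n.-tuple R) :=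
  [set f | (forall a, minimal r a -> 0 <= tnth f a <= 1) /\
           (forall a b, covers r a b -> 0 <= tnth f b - tnth f a <= 1)].

Definition hypersimplex (top : 'I_n) (k : nat) : set (n.-tuple R) :=
  [set f | lipschitz_polytope f /\ k%:R - 1 <= tnth f top <= k%:R].

End Polytopes.

Arguments hypersimplex R {n} r top k.

(* Main.v *)
Require Import Defs.
From mathcomp Require Import all_boot all_order all_algebra all_fingroup.
From mathcomp Require Import all_classical all_reals all_analysis.
From mathcomp Require Import zify lra.

(** Off a null set, a point [t] of R^n has non-integral coordinates with pairwise
    distinct fractional parts, so it lies in exactly one cell, given by the
    integral parts [v] and the permutation [tau] ranking the fractional parts.
    Lebesgue measure is invariant under integral translations and coordinate
    permutations, so all cells have the same volume; as n! of them tile the unit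
    cube, it is 1/n!. The inequality 0 <= t_b - t_a <= 1 on a cover a < b says
    that [v] goes up by one from a to b if [tau] has a descent there, and is
    constant otherwise. Hence the cells meeting the Lipschitz polytope are
    contained in it, and they are those with [tau] descent-compatible and
    [v = des_(P,tau)]. *)

Set Implicit Arguments.
Unset Strict Implicit.
Unset Printing Implicit Defensive.

Import Order.TTheory GRing.Theory Num.Theory.

Local Open Scope classical_set_scope.
Local Open Scope ring_scope.

(** * Boxes as generators of the product sigma-algebra *)

Definition box (T : Type) n (B : 'I_n -> set T) : set (n.-tuple T) :=
  [set t | forall i, B i (tnth t i)].

Lemma measurable_box d (T : measurableType d) n (B : 'I_n -> set T) :
  (forall i, measurable (B i)) -> measurable (box B).
Proof.
move=> mB.
rewrite [X in measurable X](_ : _ =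
    \bigcap_(i in [set: 'I_n]) (fun t => tnth t i) @^-1` B i); last first.
  by apply/seteqP; split => t h i; [move=> _; exact: h|exact: (h i I)].
apply: fin_bigcap_measurable => // i _; rewrite -[X in measurable X]setTI.
exact: measurable_tnth.
Qed.

(** The preimage of a set under one coordinate is a box with a single nontrivial side. Boxes, unlike
    such preimages, are stable under intersection, as uniqueness of measures requires. *)
Lemma measurable_tuple_boxE d (T : measurableType d) n :
  @measurable _ (n.-tuple T) =
  <<s [set A | exists2 B : 'I_n -> set T,
        (forall i, measurable (B i)) & A = box B] >>.
Proof.
apply/seteqP; split; last first.
  apply: smallest_sub; first exact: sigma_algebra_measurable.
  by move=> _ [B mB ->]; exact: measurable_box.
apply: smallest_sub; first exact: smallest_sigma_algebra.
elim/big_ind: _ => [//|E F hE hF A [/hE//|/hF//]|i _ _ [C mC <-]].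
apply: sub_sigma_algebra.
exists (fun j => if j == i then C else setT); first by move=> j; case: ifP.
apply/seteqP; split => [t [_ Ct] j|t /(_ i)]; last by rewrite eqxx.
by case: eqP => // ->.
Qed.

(** * Invariance of Lebesgue measure under translations and coordinate permutations *)

Section LebesgueTupleInvariance.
Variable R : realType.
Local Notation mT := (measurableTypeR R).

Lemma lebesgue_tuple_measurable_box n (B : 'I_n -> set mT) :
  (forall i, measurable (B i)) ->
  lebesgue_tuple R n (box B) = (\prod_(i < n) (@lebesgue_measure R (B i)))%E.
Proof.
elim: n B => [|n IH] B mB /=.
  by rewrite big_ord0 diracE mem_set//= => -[].
rewrite /lebesgue_step /pushforward.
rewrite (_ : _ @^-1` _ = B ord0 `*` box (fun i => B (lift ord0 i))); last first.
  apply/seteqP; split => -[x t] /=.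
    move=> h; split; first exact: (h ord0).
    by move=> i; have := h (lift ord0 i); rewrite tnthS.
  move=> -[hx ht] i; case: (unliftP ord0 i) => [j ->|->//].
  by rewrite tnthS; exact: ht.
rewrite product_measure1E//; last by apply: measurable_box.
by rewrite IH// big_ord_recl.
Qed.

Lemma measurable_addr (c : R) :
  measurable_fun [set: mT] ((fun x : R => x + c) : mT -> mT).
Proof. exact: measurable_realfun.measurable_funD. Qed.

Lemma lebesgue_measure_translation (c : R) (A : set mT) : measurable A ->
  lebesgue_measure ((fun x : R => x + c) @^-1` A) = lebesgue_measure A :> \bar R.
Proof.
move=> mA.
have mf := measurable_addr c.
apply: esym; change (lebesgue_measure A =
  pushforward lebesgue_measure ((fun x : R => x + c) : mT -> mT) A).
apply: lebesgue_measure_unique => // _ [[a b] _ <-] /=.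
rewrite /pushforward (_ : _ @^-1` _ = `]a - c, b - c]%classic); last first.
  by apply/seteqP; split=> x /=; rewrite !in_itv/= ltrBlDr lerBrDr.
rewrite !lebesgue_measure_itv/= !lte_fin ltrD2r; case: ifP => // _.
by rewrite -!EFinD opprB addrA subrK.
Qed.

(** Permutation and translation are combined in one map so that a single change of variables carries
    any cell to the base cell. *)
Definition shuffle_shift n (s : 'S_n) (v : 'I_n -> R) (t : n.-tuple mT) :
  n.-tuple mT := [tuple tnth t (s i) + v i | i < n].

Lemma measurable_shuffle_shift n (s : 'S_n) (v : 'I_n -> R) :
  measurable_fun setT (shuffle_shift s v).
Proof.
apply/measurable_fun_tnthP => i.
rewrite (_ : _ \o _ = fun t : n.-tuple mT => (tnth t (s i) + v i : R));
  last first.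
  by apply/funext => t /=; rewrite tnth_mktuple.
apply: measurable_realfun.measurable_funD => //; exact: measurable_tnth.
Qed.

(** The preimage of a box is a box with permuted and translated sides, so the measure and its
    pushforward agree on boxes, hence on all measurable sets. *)
Lemma lebesgue_tuple_shuffle_shift n (s : 'S_n) (v : 'I_n -> R)
    (A : set (n.-tuple mT)) : measurable A ->
  lebesgue_tuple R n (shuffle_shift s v @^-1` A) = lebesgue_tuple R n A.
Proof.
move=> mA; have mf := measurable_shuffle_shift s v.
apply: esym; change (lebesgue_tuple R n A =
  pushforward (lebesgue_tuple R n) (shuffle_shift s v) A).
(* The cubes [g k] exhaust the space and have finite measure, which makes the uniqueness theorem
   applicable. *)
pose g (k : nat) : set (n.-tuple mT) := box (fun=> `[- k%:R, k%:R]%classic).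
apply: (measure_unique _ g (measurable_tuple_boxE _ _)) => //.
- move=> _ _ [B mB ->] [C mC ->]; exists (fun i => B i `&` C i).
    by move=> i; exact: measurableI.
  apply/seteqP; split => [t [h1 h2] i //|t h].
  by split=> i; case: (h i).
- by move=> k; exists (fun=> `[- k%:R, k%:R]%classic).
- apply/seteqP; split => // t _.
  (* The sum of all absolute values bounds every coordinate at once. *)
  exists (Num.bound (\sum_i `|tnth t i|)) => // i /=.
  rewrite in_itv/= -ler_norml.
  apply: le_trans (ltW (archi_boundP _)); last by apply: sumr_ge0.
  by rewrite (bigD1 i)//= lerDl sumr_ge0.
- move=> _ [B mB ->]; rewrite [LHS]lebesgue_tuple_measurable_box//= /pushforward.
  rewrite (_ : _ @^-1` _ = box (fun j =>
      (fun x : R => x + v (s^-1%g j)) @^-1` B (s^-1%g j))); last first.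
    apply/seteqP; split => t h i /=.
      by have := h (s^-1 i)%g; rewrite tnth_mktuple permKV.
    by rewrite tnth_mktuple; have := h (s i); rewrite /= permK.
  rewrite [RHS]lebesgue_tuple_measurable_box; last first.
    move=> j; rewrite -[X in measurable X]setTI.
    exact: measurable_addr.
  rewrite [RHS](reindex_inj (@perm_inj _ s))/=; apply: eq_bigr => i _.
  by rewrite permK lebesgue_measure_translation.
- move=> k; have kN (i : 'I_n) : - k%:R <= k%:R :> R.
    by rewrite (@le_trans _ _ 0)// lerNl oppr0.
  have := lebesgue_tuple_box kN.
  rewrite (_ : [set t | _] = g k) => [h|]; first by rewrite [ltLHS]h ltry.
  by apply/seteqP; split => t h i; have := h i; rewrite /= in_itv.
Qed.

End LebesgueTupleInvariance.

(** * Null hyperplanes and generic points *)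

Section NullSets.
Variable R : realType.
Local Notation mT := (measurableTypeR R).

Lemma measurable_tnthB n (i j : 'I_n) (A : set mT) : measurable A ->
  measurable [set t : n.-tuple mT | A (tnth t i - tnth t j)].
Proof.
move=> mA; rewrite -[X in measurable X]setTI.
apply: (measurable_realfun.measurable_funB
  (f := fun t : n.-tuple mT => tnth t i : R)
  (g := fun t : n.-tuple mT => tnth t j)) => //; exact: measurable_tnth.
Qed.

Lemma lebesgue_tuple_tnth_eq0 n (i : 'I_n) (c : R) :
  lebesgue_tuple R n [set t | tnth t i = c] = 0%E.
Proof.
rewrite (_ : [set t | _] = box (fun j => if j == i then [set c] else setT)).
  rewrite lebesgue_tuple_measurable_box; last by move=> j; case: ifP.
  by rewrite (bigD1 i)//= eqxx lebesgue_measure_set1 mul0e.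
apply/seteqP; split => [t /= tc j|t /(_ i)]; last by rewrite eqxx.
by case: eqP => // ->.
Qed.

(** If one index is the first, Fubini applies: fixing the first coordinate leaves a null hyperplane
    on which another coordinate is constant. Otherwise the first coordinate splits off as a full
    factor and induction applies. *)
Lemma lebesgue_tuple_tnthB_eq0 n (i j : 'I_n) (c : R) : i != j ->
  lebesgue_tuple R n [set t | tnth t i - tnth t j = c] = 0%E.
Proof.
elim: n i j c => [[]//|n IH] i j c.
have section_eq0 k d : lebesgue_tuple R n.+1
    [set t | tnth t ord0 - tnth t (lift ord0 k) = d] = 0%E.
  rewrite /= /lebesgue_step /pushforward /product_measure1.
  apply: integral0_eq => x _ /=.
  rewrite (_ : xsection _ _ = [set t | tnth t k = x - d]).
    exact: lebesgue_tuple_tnth_eq0.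
  apply/seteqP; split => t; rewrite /xsection /= inE /= tnthS => h.
    by rewrite -h opprB addrC subrK.
  by rewrite h opprB addrC subrK.
case: (unliftP ord0 i) => [i' ->|->]; case: (unliftP ord0 j) => [j' ->|->] ij.
- rewrite /= /lebesgue_step /pushforward.
  rewrite (_ : _ @^-1` _ = setT `*`
      [set t : n.-tuple mT | tnth t i' - tnth t j' = c]); last first.
    by apply/seteqP; split => -[x t] /=; rewrite !tnthS => // -[].
  rewrite product_measure1E//; last first.
    exact: (@measurable_tnthB n i' j' [set c] (measurable_set1 c)).
  by rewrite IH ?mule0//; apply: contraNneq ij => ->.
(* Negating the difference reduces this case to [section_eq0] with constant [- c]. *)
- rewrite -[RHS](section_eq0 i' (- c)); congr (lebesgue_tuple R n.+1 _).
  apply/seteqP; split => t /= h; first by rewrite -h opprB.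
  by rewrite -opprB h opprK.
- exact: section_eq0.
- by rewrite eqxx in ij.
Qed.

Definition generic n (t : n.-tuple mT) :=
  (forall i (z : int), tnth t i != z%:~R) /\
  (forall i j (z : int), i != j -> tnth t i - tnth t j != z%:~R).

Lemma negligible_nongeneric n :
  (lebesgue_tuple R n).-negligible [set t | ~ generic t].
Proof.
(* The exceptional hyperplanes are countable, coded by triples [(i, j, z)]; the diagonal triples
   code the condition that coordinate [i] equals [z]. *)
pose F k : set (n.-tuple mT) :=
  if unpickle k is Some (i, j, z) then
    if i == j then [set t | tnth t i = z%:~R]
    else [set t | tnth t i - tnth t j = z%:~R]
  else set0.
apply: (@negligibleS _ _ _ _ (\bigcup_k F k)); last first.
  apply: negligible_bigcup => k; rewrite /F.
  case: unpickle => [[[i j] z]|]; last exact: negligible_set0.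
  case: eqVneq => [_|ij].
    apply/negligibleP; last exact: lebesgue_tuple_tnth_eq0.
    rewrite -[X in measurable X]setTI.
    exact: (measurable_tnth i measurableT (measurable_set1 (z%:~R : R))).
  apply/negligibleP; last exact: lebesgue_tuple_tnthB_eq0.
  exact: (@measurable_tnthB n i j [set z%:~R] (measurable_set1 _)).
move=> t /not_andP[/existsNP[i /existsNP[z /negP]]|].
  rewrite negbK => /eqP tz; exists (pickle (i, i, z)) => //.
  by rewrite /F pickleK eqxx.
move=> /existsNP[i /existsNP[j /existsNP[z /not_implyP[ij /negP]]]].
rewrite negbK => /eqP tz; exists (pickle (i, j, z)) => //.
by rewrite /F pickleK (negPf ij).
Qed.

End NullSets.

(** * Cells and their common volume *)

Section Cells.
Variable R : realType.
Local Notation mT := (measurableTypeR R).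

(** An open simplex of the standard triangulation of the unit cube with lowest corner [v]. *)
Definition cell n (tau : 'S_n) (v : 'I_n -> int) : set (n.-tuple mT) :=
  [set t | (forall i, 0 < tnth t i - (v i)%:~R < 1) /\
           (forall i j, (tau i < tau j)%N ->
              tnth t i - (v i)%:~R < tnth t j - (v j)%:~R)].

Lemma cell_lt n (tau : 'S_n) v (t : n.-tuple mT) i j : cell tau v t ->
  (tnth t i - (v i)%:~R < tnth t j - (v j)%:~R) = (tau i < tau j)%N.
Proof.
move=> [_ tl]; apply/idP/idP => [h|/tl//].
have [//|ji|/val_inj/perm_inj ij] := ltngtP (tau i) (tau j).
  by move: (lt_trans h (tl _ _ ji)); rewrite ltxx.
by move: h; rewrite ij ltxx.
Qed.

Lemma cell_floor n (tau : 'S_n) v (t : n.-tuple mT) i :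
  cell tau v t -> v i = Num.floor (tnth t i : R).
Proof.
move=> [/(_ i)/andP[t0 t1] _]; apply/esym/floor_def.
by rewrite -subr_ge0 ltW//= intrD addrC -ltrBlDr.
Qed.

(** Both integral parts are the floors of [t], and [tau i] is then recovered as the number of
    fractional parts below that of coordinate [i]. *)
Lemma cell_inj n (tau sigma : 'S_n) v w (t : n.-tuple mT) :
  cell tau v t -> cell sigma w t -> tau = sigma.
Proof.
move=> ht hs; have vw : v = w.
  by apply/funext => i; rewrite (cell_floor i ht) (cell_floor i hs).
rewrite -{w}vw in hs.
have rk (rho : 'S_n) i : cell rho v t -> (rho i : nat) =
    #|[set j | tnth t j - (v j)%:~R < tnth t i - (v i)%:~R]%SET|.
  move=> hr; rewrite -sum1_card (reindex_inj (@perm_inj _ rho^-1%g)) /=.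
  rewrite (eq_bigl (fun j : 'I_n => j < rho i)%N) => [|j]; last first.
    by rewrite inE (cell_lt _ _ hr) permKV.
  by rewrite -(big_ord_widen n (fun=> 1%N) (ltnW (ltn_ord _))) sum1_card card_ord.
by apply/permP => i; apply/val_inj; rewrite /= (rk _ _ ht) (rk _ _ hs).
Qed.

(** The permutation sends [i] to the number of coordinates with smaller fractional part;
    distinctness of the fractional parts makes this rank injective. *)
Lemma generic_cell n (t : n.-tuple mT) : generic t ->
  exists tau : 'S_n, cell tau (fun i => Num.floor (tnth t i : R)) t.
Proof.
move=> [tZ tBZ].
pose x i : R := tnth t i - (Num.floor (tnth t i : R))%:~R.
have x_inj : injective x.
  move=> i j /eqP; rewrite /x => xij; apply/eqP/negPn/negP => ij.
  have /negP := tBZ i j (Num.floor (tnth t i : R) - Num.floor (tnth t j : R)) ij.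
  by apply; rewrite intrB subr_eq -addrA [- _ + _]addrC addrC -subr_eq.
pose S i := [set j | x j < x i]%SET.
have S_lt i : (#|S i| < n)%N.
  rewrite -[X in (_ < X)%N]card_ord -cardsT; apply: proper_card.
  by apply/properP; split; [exact: finset.subsetT|exists i; rewrite inE// ltxx].
have S_mono i j : x i < x j -> (#|S i| < #|S j|)%N.
  move=> xij; apply: proper_card; apply/properP; split.
    by apply/fintype.subsetP => k; rewrite !inE => /lt_trans; exact.
  by exists i; rewrite !inE ?ltxx.
have rk_inj : injective (fun i => Ordinal (S_lt i)).
  move=> i j [Sij]; apply: x_inj; apply/eqP; rewrite eq_le !leNgt.
  by apply/andP; split; apply/negP => /S_mono; rewrite Sij ltnn.
exists (perm rk_inj); split=> [i|i j].
  rewrite subr_gt0 lt_neqAle eq_sym tZ/= floor_le ltrBlDl -[1]/(1%:~R) -intrD.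
  by rewrite floorD1_gt.
rewrite !permE /= ltnNge => ij; rewrite ltNge; apply: contra ij.
rewrite le_eqVlt => /predU1P[/x_inj -> //|/S_mono/ltnW//].
Qed.

Lemma measurable_cell n (tau : 'S_n) v : measurable (cell tau v).
Proof.
pose a i : R := (v i)%:~R.
rewrite (_ : cell tau v = box (fun i => `]a i, a i + 1[%classic) `&`
    \bigcap_(p in [set p : 'I_n * 'I_n | (tau p.1 < tau p.2)%N])
      [set t | `]-oo, a p.1 - a p.2[%classic (tnth t p.1 - tnth t p.2)]).
  apply: measurableI; first by apply: measurable_box => i; exact: measurable_itv.
  apply: fin_bigcap_measurable => // p _.
  exact: (measurable_tnthB p.1 p.2 (measurable_itv `]-oo, a p.1 - a p.2[)).
have aux (x y c d : R) : (x - c < y - d) = (x - y < c - d).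
  by rewrite !ltrBlDr addrAC [y + c]addrC addrAC.
apply/seteqP; split => t [h1 h2]; split => [i|].
- by have := h1 i; rewrite /= in_itv/= subr_gt0 ltrBlDl.
- by move=> [i j] /h2; rewrite /= in_itv/= aux.
- by have := h1 i; rewrite /= in_itv/= subr_gt0 ltrBlDl.
- by move=> i j ij; have := h2 (i, j) ij; rewrite /= in_itv/= aux.
Qed.

(** Subtracting [v] and sorting the coordinates by [tau] turns this cell into the base cell. *)
Lemma lebesgue_tuple_cell n (tau : 'S_n) v :
  lebesgue_tuple R n (cell tau v) = lebesgue_tuple R n (cell 1%g (fun=> 0)).
Proof.
rewrite -[RHS](lebesgue_tuple_shuffle_shift tau^-1%g
  (fun i => - (v (tau^-1%g i))%:~R)); last exact: measurable_cell.
congr (lebesgue_tuple R n _); apply/seteqP; split => t [h1 h2].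
  split=> [i|i j ij]; rewrite /= !tnth_mktuple !subr0//.
  by apply: h2; rewrite !permKV; rewrite !perm1 in ij.
split=> [i|i j ij].
  by have := h1 (tau i); rewrite tnth_mktuple permK subr0.
by have := h2 (tau i) (tau j); rewrite !perm1 !tnth_mktuple !permK !subr0; apply.
Qed.

(** Serves both the unit cube, with all of ['S_n] and [v = 0], and the hypersimplex. Cells of
    different permutations are disjoint even when their integral parts differ, so the volumes add
    up. *)
Lemma lebesgue_tuple_cells n (D : {set 'S_n}) (v : 'S_n -> 'I_n -> int)
    (A : set (n.-tuple mT)) : measurable A ->
  (forall tau, tau \in D -> cell tau (v tau) `<=` A) ->
  (forall t, A t -> generic t -> exists2 tau, tau \in D & cell tau (v tau) t) ->
  lebesgue_tuple R n A =
  (#|D|%:R%:E * lebesgue_tuple R n (cell 1%g (fun=> 0%R)))%E.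
Proof.
move=> mA DA AD.
pose B := \bigcup_(tau in [set` D]) cell tau (v tau).
have mB : measurable B.
  by apply: fin_bigcup_measurable => // tau _; exact: measurable_cell.
have -> : lebesgue_tuple R n A = lebesgue_tuple R n B.
  (* [A] lies in the union [B] of the cells up to the null set [N] of nongeneric points, and
     contains [B]. *)
  have [N [mN N0 hN]] := @negligible_nongeneric R n.
  apply/le_anti/andP; split.
    rewrite -(measureU0 mB mN N0); apply: le_measure; rewrite ?inE//.
      exact: measurableU.
    move=> t At; have [gt|ngt] := pselect (generic t); last by right; exact: hN.
    by have [tau tD h] := AD _ At gt; left; exists tau.
  by apply: le_measure; rewrite ?inE// => t [tau tD]; exact: DA.
rewrite measure_fin_bigcup//=; last 2 first.
  by move=> tau sigma _ _ [t [ht hs]]; exact: cell_inj ht hs.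
  by move=> tau _; exact: measurable_cell.
rewrite -(@bigfs _ _ _ _ (index_enum 'S_n))//; last 2 first.
  exact: index_enum_uniq.
  by move=> i _; rewrite mem_index_enum.
under eq_bigr do rewrite lebesgue_tuple_cell.
by rewrite big_const iter_addr addr0 mule_natl.
Qed.

Lemma lebesgue_tuple_cell_fact n :
  (n`!%:R%:E * lebesgue_tuple R n (cell 1%g (fun=> 0%R)) = 1)%E.
Proof.
pose A : set (n.-tuple mT) := [set t | forall i, 0 <= tnth t i <= 1].
have mA : measurable A.
  rewrite (_ : A = box (fun=> `[0, 1]%classic)).
    by apply: measurable_box => i; exact: measurable_itv.
  by apply/seteqP; split => t h i; have := h i; rewrite /= in_itv.
have h01 (i : 'I_n) : 0 <= 1 :> R by [].
have := lebesgue_tuple_box h01.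
rewrite big1 => [|i _]; last by rewrite subr0.
move=> <-; rewrite (@lebesgue_tuple_cells n [set: 'S_n]%SET (fun=> fun=> 0) A)//.
- by rewrite cardsT card_Sn.
- by move=> tau _ t [h _] i; have /andP[] := h i; rewrite subr0 => /ltW-> /ltW->.
move=> t h gt; have [tau ht] := generic_cell gt; exists tau => //.
(* In the closed cube a floor could be 1 only at a coordinate equal to 1, which genericity
   excludes. *)
have E : (fun i => Num.floor (tnth t i : R)) = fun=> 0.
  apply/funext => i; apply/floor_def; have /andP[t0 t1] := h i.
  by rewrite t0 lt_neqAle t1 andbT (gt.1 i 1).
by rewrite E in ht.
Qed.

End Cells.

(** * Saturated chains and descent numbers *)

Section SaturatedChains.
Variables (n : nat) (r : rel 'I_n).
Hypotheses (r_poset : poset_rel r) (r_natural : naturally_labeled r).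
Local Notation bot_covers := (covers (adjoin_bot r)).

Lemma bot_covers_None (a : 'I_n) :
  reflect (minimal r a) (bot_covers None (Some a)).
Proof.
have [rr ra rt] := r_poset.
apply: (iffP and3P) => [[_ _ /forallP h] b rba|h].
  by have := h (Some b); rewrite /= rba => /eqP[].
split=> //; apply/forallP => -[b|] //=; apply/implyP => /h ->.
by rewrite eqxx.
Qed.

Lemma bot_covers_Some (a b : 'I_n) : bot_covers (Some a) (Some b) = covers r a b.
Proof.
congr [&& _, _ & _]; apply/forallP/forallP => [h c|h [c|//]].
  exact: (h (Some c)).
exact: (h c).
Qed.

Lemma bot_covers_to_None x : bot_covers x None = false.
Proof. by case: x. Qed.

(** By strong induction on the label: a nonminimal [a] covers some [b], and a chain up to [b]
    extends by [a]. *)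
Lemma exists_saturated_chain (a : 'I_n) :
  exists C, saturated_chain (adjoin_bot r) None (Some a) C.
Proof.
have [rr ra rt] := r_poset.
have [m] := ubnP (a : nat); elim: m a => // m IH a am.
have [a_min|] := pselect (minimal r a).
  by exists [:: None; Some a]; apply/and3P; split=> //; apply/andP; split=> //;
    apply/bot_covers_None.
move=> /existsNP[b0 /not_implyP[rb0 /eqP b0a]].
have P0 : r b0 a && (b0 != a) by rewrite rb0.
(* Among the elements strictly below [a], take the one of largest label; natural labeling leaves
   nothing strictly between it and [a]. *)
case: (@arg_maxnP _ b0 (fun b => r b a && (b != a)) (fun b => b : nat) P0).
move=> b /andP[rba ba] b_max.
have ba_lt : (b < a)%N by exact: r_natural.
have ab : covers r b a.
  rewrite /covers rba ba; apply/forallP => c; apply/implyP => /andP[rbc rca].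
  rewrite orbC; have [//|ca /=] := eqVneq c a.
  rewrite eq_sym; apply: contraT => bc.
  have := b_max c; rewrite rca ca => /(_ isT).
  by rewrite /= leqNgt (r_natural rbc).
have [//|C] := IH b; first exact: leq_trans ba_lt _.
case: C => [//|c s] /and3P[/eqP c0 sp /eqP sl].
exists (c :: rcons s (Some a)).
by rewrite /= c0 eqxx rcons_path last_rcons eqxx andbT -c0 sp sl bot_covers_Some.
Qed.

Lemma des_chain_cons2 (tau : 'S_n) x y s :
  des_chain tau (x :: y :: s) =
  ((perm_label tau y < perm_label tau x) + des_chain tau (y :: s))%N.
Proof. by rewrite /des_chain big_ord_recl. Qed.

Lemma des_chain_rcons (tau : 'S_n) x s y :
  des_chain tau (x :: rcons s y) =
  (des_chain tau (x :: s) +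
     (perm_label tau y < perm_label tau (last x s)))%N.
Proof.
elim: s x => [|z s IH] x /=.
  by rewrite des_chain_cons2 /des_chain !big_ord0 addnC.
by rewrite !des_chain_cons2 IH addnA.
Qed.

(** Telescoping along the chain. A potential [m] makes the descent number depend on the endpoints
    only, which is how descent-compatibility is obtained. *)
Lemma des_chain_potential (tau : 'S_n) (m : option 'I_n -> int) x s :
  (forall y z, bot_covers y z ->
     m z = m y + (perm_label tau z < perm_label tau y)%N%:Z) ->
  path bot_covers x s -> m (last x s) = m x + (des_chain tau (x :: s))%:Z.
Proof.
move=> mE; elim: s x => [|y s IH] x /=.
  by rewrite /des_chain big_ord0 addr0.
by move=> /andP[xy /IH->]; rewrite des_chain_cons2 (mE _ _ xy) PoszD addrA.
Qed.

Lemma poset_desE (tau : 'S_n) a C : descent_compatible r tau ->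
  saturated_chain (adjoin_bot r) None (Some a) C ->
  des_chain tau C = poset_des r tau a.
Proof.
move=> tauDC Ca; rewrite /poset_des.
case: xgetP => [d _ [D Da <-]|/(_ (des_chain tau C))].
  exact: tauDC Ca Da.
by case; exists C.
Qed.

Lemma poset_des_minimal (tau : 'S_n) a : descent_compatible r tau ->
  minimal r a -> poset_des r tau a = 0%N.
Proof.
move=> tauDC /bot_covers_None a_min.
rewrite -(@poset_desE tau a [:: None; Some a])//.
  by rewrite /des_chain big_ord_recl big_ord0.
by rewrite /= a_min eqxx.
Qed.

(** A chain up to [a] extends by [b], and compatibility allows computing the descents of [b] on this
    chain. *)
Lemma poset_des_covers (tau : 'S_n) a b : descent_compatible r tau ->
  covers r a b ->
  poset_des r tau b = (poset_des r tau a + (tau b < tau a))%N.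
Proof.
move=> tauDC ab; have [[//|c s] Ca] := exists_saturated_chain a.
rewrite -(poset_desE tauDC Ca).
have /and3P[c0 sp /eqP sl] := Ca.
rewrite -(@poset_desE tau b (c :: rcons s (Some b)))//.
  by rewrite des_chain_rcons sl ltnS.
by rewrite /= c0 rcons_path sp sl last_rcons eqxx bot_covers_Some ab.
Qed.

End SaturatedChains.

(** * The hypersimplex as a union of cells *)

Section Hypersimplex.
Variables (R : realType) (n : nat) (r : rel 'I_n).
Hypotheses (r_poset : poset_rel r) (r_natural : naturally_labeled r).
Local Notation mT := (measurableTypeR R).

Lemma cell_lipschitz (tau : 'S_n) (t : n.-tuple mT) :
  descent_compatible r tau ->
  cell tau (fun a => (poset_des r tau a)%:Z) t -> lipschitz_polytope r t.
Proof.
move=> tauDC tcell; split=> [a a_min|a b ab].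
  have /andP[] := tcell.1 a.
  by rewrite (poset_des_minimal r_poset tauDC a_min) subr0 => /ltW-> /ltW->.
have /andP[a0 a1] := tcell.1 a; have /andP[b0 b1] := tcell.1 b.
have := cell_lt a b tcell; have := cell_lt b a tcell.
move: a0 a1 b0 b1.
rewrite (poset_des_covers r_poset r_natural tauDC ab) PoszD intrD.
move: (tnth t a : R) (tnth t b : R) ((poset_des r tau a)%:~R : R) => x y d.
(* At an ascent the integral parts agree and the fractional part grows; at a descent the integral
   part grows by one and the fractional part drops. Either way the difference stays between 0 and
   1. *)
case: (ltngtP (tau a) (tau b)) => [_|_|/val_inj/perm_inj ba].
- by rewrite mulr0z => *; apply/andP; split; lra.
- by rewrite mulr1z => *; apply/andP; split; lra.
- by move: ab; rewrite /covers ba eqxx andbF.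
Qed.

Lemma lipschitz_generic_cell (t : n.-tuple mT) : lipschitz_polytope r t ->
  generic t -> exists2 tau : 'S_n, descent_compatible r tau &
    cell tau (fun a => (poset_des r tau a)%:Z) t.
Proof.
move=> [t_min t_cov] gt; have [tau tcell] := generic_cell gt.
(* The floors of [t], extended by 0 at the adjoined minimum, form a potential for descents. *)
pose m x : int := if x is Some a then Num.floor (tnth t a : R) else 0.
have mE y z : covers (adjoin_bot r) y z ->
    m z = m y + (perm_label tau z < perm_label tau y)%N%:Z.
  case: z => [b|]; last by rewrite bot_covers_to_None.
  case: y => [a|] /=.
    rewrite bot_covers_Some ltnS => ab.
    have /andP[ab0 ab1] := t_cov _ _ ab.
    have /andP[a0 a1] := tcell.1 a; have /andP[b0 b1] := tcell.1 b.
    have := cell_lt b a tcell; have := cell_lt a b tcell.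
    move: ab0 ab1 a0 a1 b0 b1; move: (Num.floor _) (Num.floor _) => fb fa.
    move: (tnth t a : R) (tnth t b : R) => x y.
    (* The Lipschitz bounds and the order of the fractional parts confine [fb] to an open interval
       of length two with integral ends: its midpoint is [fa] at an ascent and [fa + 1] at a
       descent. *)
    case: (ltngtP (tau a) (tau b)) => [_|_|/val_inj/perm_inj ba] => [||*].
    - move=> *; have lb : (fa - 1)%:~R < fb%:~R :> R by rewrite intrB; lra.
      have ub : fb%:~R < (fa + 1)%:~R :> R by rewrite intrD; lra.
      by move: lb ub; rewrite !ltr_int; lia.
    - move=> *; have lb : fa%:~R < fb%:~R :> R by lra.
      have ub : fb%:~R < (fa + 2)%:~R :> R by rewrite intrD; lra.
      by move: lb ub; rewrite !ltr_int; lia.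
    - by move: ab; rewrite /covers ba eqxx andbF.
  (* The label 0 of the bottom never starts a descent, and the floor at a minimal element is 0
     because genericity excludes the value 1. *)
  move=> /(bot_covers_None r_poset)/t_min/andP[b0 b1].
  rewrite addr0; apply/floor_def; rewrite b0 lt_neqAle b1 andbT.
  exact: (gt.1 b 1).
have desE a C : saturated_chain (adjoin_bot r) None (Some a) C ->
    (des_chain tau C)%:Z = Num.floor (tnth t a : R).
  case: C => [//|c s] /and3P[/eqP-> /(des_chain_potential mE) + /eqP sl].
  by rewrite sl /= add0r.
have tauDC : descent_compatible r tau.
  by move=> a C D /desE Ca /desE Da; apply/eqP; rewrite -eqz_nat Ca Da.
exists tau => //; congr (cell tau _ t): tcell; apply/funext => a.
have [C Ca] := exists_saturated_chain r_poset r_natural a.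
by rewrite -(poset_desE tauDC Ca) (desE _ _ Ca).
Qed.

Lemma measurable_hypersimplex top k :
  measurable (hypersimplex R r top k : set (n.-tuple mT)).
Proof.
have mcoord i (a b : R) :
    measurable [set t : n.-tuple mT | a <= tnth t i <= b].
  rewrite -[X in measurable X]setTI.
  rewrite (_ : [set t | _] = (fun t : n.-tuple mT => tnth t i) @^-1` `[a, b]).
    by apply: measurable_tnth => //; exact: measurable_itv.
  by apply/seteqP; split=> t; rewrite /= in_itv.
rewrite (_ : hypersimplex R r top k =
    (\bigcap_(a in minimal r) [set t | 0 <= tnth t a <= 1] `&`
     \bigcap_(p in [set p | covers r p.1 p.2])
       [set t | `[0, 1]%classic (tnth t p.2 - tnth t p.1)]) `&`
    [set t | k%:R - 1 <= tnth t top <= k%:R]).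
  apply: measurableI => //; apply: measurableI.
    by apply: fin_bigcap_measurable => // a _.
  apply: fin_bigcap_measurable => // p _.
  exact: (measurable_tnthB p.2 p.1 (measurable_itv `[0, 1])).
apply/seteqP; split => t [[h1 h2] h3]; split=> //; split=> //.
  by move=> [a b] /h2; rewrite /= in_itv.
by move=> a b ab; have := h2 (a, b) ab; rewrite /= in_itv.
Qed.

End Hypersimplex.

Theorem corollary5p3 (R : realType) (n : nat) (r : rel 'I_n) (top : 'I_n) (k : nat)
    (r_poset : poset_rel r) (r_natural : naturally_labeled r)
    (top_max : unique_maximal r top) (k_bounds : (1 <= k <= height r)%N) :
  ((n`!)%:R%:E * lebesgue_tuple R n (hypersimplex R r top k) =
   #|[set tau in DC r | poset_des r tau top == k.-1]%SET|%:R%:E)%E.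
Proof.
(* As [k] is positive, [k.-1] is a genuine predecessor. *)
have kE : k%:R = k.-1%:R + 1 :> R.
  by case/andP: k_bounds => k0 _; rewrite -[in LHS](prednK k0) -natr1.
rewrite (@lebesgue_tuple_cells R n
   [set tau in DC r | poset_des r tau top == k.-1]%SET
   (fun tau a => (poset_des r tau a)%:Z)).
- by rewrite muleCA lebesgue_tuple_cell_fact mule1.
- exact: measurable_hypersimplex.
- move=> tau; rewrite !inE => /andP[/asboolP tauDC /eqP dk] t tcell.
  split; first exact: (cell_lipschitz r_poset r_natural tauDC tcell).
  have := tcell.1 top; rewrite dk kE addrK subr_gt0 ltrBlDl.
  by case/andP=> /ltW-> /ltW.
move=> t [tL /andP[tk1 tk]] gt.
have [tau tauDC tcell] := lipschitz_generic_cell r_poset r_natural tL gt.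
exists tau => //; rewrite !inE; apply/andP; split; first exact/asboolP.
have := cell_floor top tcell.
(* Genericity excludes the value [k] at the top, so the floor there, which counts the descents, is
   [k.-1]. *)
rewrite (_ : Num.floor _ = k.-1%:Z) => [[->]//|].
apply/floor_def; rewrite intrD -kE.
move: tk1; rewrite kE addrK => ->/=.
by rewrite lt_neqAle -kE tk andbT (gt.1 top k).
Qed.
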